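(* Let $\mathbf B=[\hat{\mathbf A}^1,\dots,\hat{\mathbf A}^{Q_A},\hat{\mathbf b}^1,\dots,\hat{\mathbf b}^{Q_b}]\in\mathbb R^{\mathcal N\times Q_B}$ with $Q_B=mQ_A+Q_b$, and let $\mathbf Q\mathbf R=\mathbf B\mathbf P$ be an economy QR factorization of $\mathbf B$ with column pivoting, where $\mathbf Q\in\mathbb R^{\mathcal N\times s}$ has orthonormal columns, $\mathbf R\in\mathbb R^{s\times Q_B}$ is upper triangular and $\mathbf P\in\mathbb R^{Q_B\times Q_B}$ is a permutation matrix. Denote $$\boldsymbol\theta^A(\mu)=[\theta_1^A(\mu),\dots,\theta_{Q_A}^A(\mu)]^T,\qquad \boldsymbol\theta^b(\mu)=[\theta_1^b(\mu),\dots,\theta_{Q_b}^b(\mu)]^T .$$ Then for every $\mu\in\mathcal P$ and every $\mathbf c\in\mathbb R^m$, $$\|\mathbf A_\mu\,\mathcal U_{RB}^m\mathbf c-\mathbf b_\mu\|_{\mathcal M_h}=\|\hat{\mathbf A}_\mu\mathbf c-\hat{\mathbf b}_\mu\|_{\ell_2}=\left\|\mathbf R\mathbf P^T\begin{bmatrix}\boldsymbol\theta^A(\mu)\otimes\mathbf c\\ -\boldsymbol\theta^b(\mu)\end{bmatrix}\right\|_{\ell_2},$$ where $\otimes$ is the Kronecker product.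
   Context: Full order model. $\mathcal P\subset\mathbb R^d$ is a compact parameter set. The spatial domain $\Omega_{\mathbf x}=[x_L,x_R]\times[y_L,y_R]$ is partitioned into a Cartesian mesh $\mathcal T_h$; $\hat U_h^K=\{u: u|_T\in Q^K(T)\ \forall T\in\mathcal T_h\}$ ($Q^K(T)$: polynomials of degree at most $K$ in each spatial variable), with a basis $\{\phi_k\}_{k=1}^{N_{\mathbf x}}$, each $\phi_k$ supported in a single element. $\{\mathbf v_j\}_{j=1}^{N_{\mathbf v}}$ are angular quadrature points on the unit sphere with positive weights $\omega_j$ satisfying $\sum_j\omega_j=1$. Set $\mathcal N=N_{\mathbf x}N_{\mathbf v}$. $\mathbf M\in\mathbb R^{N_{\mathbf x}\times N_{\mathbf x}}$ is the mass matrix $(\mathbf M)_{kl}=\int_{\Omega_{\mathbf x}}\phi_k\phi_l\,d\mathbf x$. The full order system for the parametric radiative transfer equation is $\mathbf A_\mu\mathbf f_\mu=\mathbf b_\mu$, with $\mathbf A_\mu=\mathbf D+\mathbf\Sigma_{s,\mu}+\mathbf\Sigma_{a,\mu}\in\mathbb R^{\mathcal N\times\mathcal N}$, $\mathbf b_\mu\in\mathbb R^{\mathcal N}$. Here $\mathbf D=\mathrm{diag}(\mathbf D_1,\dots,\mathbf D_{N_{\mathbf v}})$ is the ($\mu$-independent) upwind discontinuous Galerkin discretization of the transport operators $\mathbf v_j\cdot\nabla_{\mathbf x}$ on $\hat U_h^K$; $\mathbf\Sigma_{a,\mu}=\mathbf I_{N_{\mathbf v}}\otimes\hat{\mathbf\Sigma}_{a,\mu}$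 and $\mathbf\Sigma_{s,\mu}=(\mathbf I_{N_{\mathbf v}}-[1,\dots,1]^T[\omega_1,\dots,\omega_{N_{\mathbf v}}])\otimes\hat{\mathbf\Sigma}_{s,\mu}$, with $(\hat{\mathbf\Sigma}_{a,\mu})_{kl}=\int\sigma_a(\mathbf x;\mu)\phi_k\phi_l\,d\mathbf x$, $(\hat{\mathbf\Sigma}_{s,\mu})_{kl}=\int\sigma_s(\mathbf x;\mu)\phi_k\phi_l\,d\mathbf x$ ($\sigma_a,\sigma_s\ge0$ absorption and scattering cross sections); $\mathbf b_\mu$ collects the source and inflow boundary data. Affine parameter dependence is assumed: $\mathbf\Sigma_{s,\mu}=\sum_{q=1}^{Q_s}\theta_q^s(\mu)\mathbf\Sigma_s^q$, $\mathbf\Sigma_{a,\mu}=\sum_{q=1}^{Q_a}\theta_q^a(\mu)\mathbf\Sigma_a^q$, $\mathbf b_\mu=\sum_{q=1}^{Q_b}\theta_q^b(\mu)\mathbf b^q$, where the matrices $\mathbf\Sigma_s^q,\mathbf\Sigma_a^q\in\mathbb R^{\mathcal N\times\mathcal N}$ and vectors $\mathbf b^q\in\mathbb R^{\mathcal N}$ are independent of $\mu$ and the coefficients are continuous real functions on $\mathcal P$. Reduced quantities. $\mathcal U_{RB}^m\in\mathbb R^{\mathcal N\times m}$, $m<\mathcal N$, has orthonormal columns (a basis of the span of the full order solution vectors $\mathbf f_{\mu_1},\dots,\mathbf f_{\mu_m}$ at $m$ selected parameters, assumed linearly independent). $\mathcal M_h=\mathrm{diag}(\omega_1\mathbf M^{-1},\dots,\omega_{N_{\mathbf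 v}}\mathbf M^{-1})$ is symmetric positive definite, with Cholesky factorization $\mathcal M_h=\mathcal G^T\mathcal G$, $\mathcal G$ upper triangular, and $\|\mathbf g\|_{\mathcal M_h}=\sqrt{\mathbf g^T\mathcal M_h\mathbf g}$. With $Q_A=1+Q_s+Q_a$, the parameter-independent matrices $\hat{\mathbf A}^1,\dots,\hat{\mathbf A}^{Q_A}\in\mathbb R^{\mathcal N\times m}$ are $\mathcal G\mathbf D\,\mathcal U_{RB}^m$, $\{\mathcal G\mathbf\Sigma_s^q\,\mathcal U_{RB}^m\}_{q=1}^{Q_s}$, $\{\mathcal G\mathbf\Sigma_a^q\,\mathcal U_{RB}^m\}_{q=1}^{Q_a}$, with respective coefficients $\theta^A_q(\mu)$ equal to $1$, $\theta_q^s(\mu)$, $\theta_q^a(\mu)$; $\hat{\mathbf b}^q=\mathcal G\mathbf b^q\in\mathbb R^{\mathcal N}$. Thus $\hat{\mathbf A}_\mu=\mathcal G\mathbf A_\mu\,\mathcal U_{RB}^m=\sum_{q=1}^{Q_A}\theta_q^A(\mu)\hat{\mathbf A}^q$ and $\hat{\mathbf b}_\mu=\mathcal G\mathbf b_\mu=\sum_{q=1}^{Q_b}\theta_q^b(\mu)\hat{\mathbf b}^q$. It is assumed throughout that $\mathcal N\ge Q_B$. ''Economy QR factorization'' of a matrix means a factorization as a matrix with orthonormal columns times an upper triangular (or upper trapezoidal) matrix. *)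

(* Defs.v *)
From HB Require Import structures.
From mathcomp Require Import all_boot all_order all_algebra.
From mathcomp.real_closed Require Export mxtens.
From mathcomp Require Import all_classical all_reals all_analysis.

Set Implicit Arguments.
Unset Strict Implicit.
Unset Printing Implicit Defensive.
Import Order.TTheory GRing.Theory Num.Theory.
Import numFieldNormedType.Exports.
Local Open Scope classical_set_scope.
Local Open Scope ring_scope.

(* Reserved by mxtens but exported by it only inside a section. *)
Notation "A *t B" := (tensmx A B) (at level 40, left associativity) : ring_scope.

(** * Mesh and discontinuous Galerkin space *)

Record cartesian_mesh (R : realType) := CartesianMesh {
  ncx : nat;
  ncy : nat;
  nodex : 'I_ncx.+1 -> R;
  nodey : 'I_ncy.+1 -> R;
  nodex_incr : forall a b : 'I_ncx.+1, (a < b)%N -> nodex a < nodex b;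
  nodey_incr : forall a b : 'I_ncy.+1, (a < b)%N -> nodey a < nodey b;
  ncx_gt0 : (0 < ncx)%N;
  ncy_gt0 : (0 < ncy)%N }.

Section Mesh.
Variables (R : realType) (Th : cartesian_mesh R).

Definition element := ('I_(ncx Th) * 'I_(ncy Th))%type.

(* Cell i lies between nodes i and i+1, which are [lift ord_max i] and
   [lift ord0 i] respectively. *)
Definition xlo (i : 'I_(ncx Th)) : R := nodex (lift ord_max i).
Definition xhi (i : 'I_(ncx Th)) : R := nodex (lift ord0 i).
Definition ylo (j : 'I_(ncy Th)) : R := nodey (lift ord_max j).
Definition yhi (j : 'I_(ncy Th)) : R := nodey (lift ord0 j).

Definition cell (T : element) : set (R * R) :=
  `[xlo T.1, xhi T.1] `*` `[ylo T.2, yhi T.2].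

Definition domain : set (R * R) :=
  `[nodex (ord0 : 'I_(ncx Th).+1), nodex (ord_max : 'I_(ncx Th).+1)] `*`
  `[nodey (ord0 : 'I_(ncy Th).+1), nodey (ord_max : 'I_(ncy Th).+1)].

Definition integral1 (a b : R) (f : R -> R) : R :=
  \int[@lebesgue_measure R]_(t in `[a, b]) f t.

Definition integral_cell (T : element) (f : R * R -> R) : R :=
  \int[(@lebesgue_measure R \x @lebesgue_measure R)%E]_(p in cell T) f p.

(* A function of the broken space is the family of its restrictions to the
   elements, so that it has one trace from each side of a face; the entry
   [u T a b] is the coefficient of x^a y^b of its restriction to T. *)
Definition dg_space (K : nat) := {ffun element -> 'M[R]_K.+1}.

Section Space.
Variable K : nat.

Definition dg_eval (u : dg_space K) (T : element) (p : R * R) : R :=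
  \sum_(a < K.+1) \sum_(b < K.+1) u T a b * p.1 ^+ a * p.2 ^+ b.

Definition single_element_support (u : dg_space K) : Prop :=
  exists T : element, forall T' : element, T' != T -> u T' = 0.

(* Since the elements overlap in a null set, the integral over the domain is
   the sum of the integrals over the elements. *)
Definition weighted_inner (sigma : R * R -> R) (u w : dg_space K) : R :=
  \sum_(T : element)
     integral_cell T (fun p => sigma p * dg_eval u T p * dg_eval w T p).

Definition source_form (G : R * R -> R) (w : dg_space K) : R :=
  \sum_(T : element) integral_cell T (fun p => G p * dg_eval w T p).

(* v . grad of the restriction of w to T; only the first two components of
   the direction act, as the spatial domain is two-dimensional. *)
Definition dir_grad (v : 'rV[R]_3) (w : dg_space K) (T : element)
    (p : R * R) : R :=
  v 0 0 * derive1 (fun x => dg_eval w T (x, p.2)) p.1 +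
  v 0 1 * derive1 (fun y => dg_eval w T (p.1, y)) p.2.

(* Upwind fluxes v_x u and v_y u across the face at node a, where g replaces
   the missing exterior trace at the boundary of the domain.  The cell before
   (after) node a is the i such that a = lift ord0 i (a = lift ord_max i). *)
Definition flux_x (v : 'rV[R]_3) (g : R * R -> R) (u : dg_space K)
    (a : 'I_(ncx Th).+1) (j : 'I_(ncy Th)) (y : R) : R :=
  let p := (nodex a, y) in
  let trace (o : option 'I_(ncx Th)) :=
    if o is Some i then dg_eval u (i, j) p else g p in
  v 0 0 * trace (if 0 <= v 0 0 then unlift ord0 a else unlift ord_max a).

Definition flux_y (v : 'rV[R]_3) (g : R * R -> R) (u : dg_space K)
    (i : 'I_(ncx Th)) (b : 'I_(ncy Th).+1) (x : R) : R :=
  let p := (x, nodey b) in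
  let trace (o : option 'I_(ncy Th)) :=
    if o is Some j then dg_eval u (i, j) p else g p in
  v 0 1 * trace (if 0 <= v 0 1 then unlift ord0 b else unlift ord_max b).

(* sum_T ( - int_T u (v . grad w) + int_{dT} (v . n) u^upwind w ). At an
   outflow face of the boundary the upwind trace is the interior one; g
   enters through the inflow boundary only. *)
Definition transport_form (v : 'rV[R]_3) (g : R * R -> R)
    (u w : dg_space K) : R :=
  \sum_(T : element)
   (- integral_cell T (fun p => dg_eval u T p * dir_grad v w T p)
    + integral1 (ylo T.2) (yhi T.2) (fun y =>
        flux_x v g u (lift ord0 T.1) T.2 y * dg_eval w T (xhi T.1, y))
    - integral1 (ylo T.2) (yhi T.2) (fun y =>
        flux_x v g u (lift ord_max T.1) T.2 y * dg_eval w T (xlo T.1, y))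
    + integral1 (xlo T.1) (xhi T.1) (fun x =>
        flux_y v g u T.1 (lift ord0 T.2) x * dg_eval w T (x, yhi T.2))
    - integral1 (xlo T.1) (xhi T.1) (fun x =>
        flux_y v g u T.1 (lift ord_max T.2) x * dg_eval w T (x, ylo T.2))).

End Space.
End Mesh.

(** * Full order model *)

Record discretization (R : realType) := Discretization {
  mesh : cartesian_mesh R;
  deg : nat;
  Nx : nat;
  phi : Nx.-tuple (dg_space mesh deg);
  phi_basis : basis_of {: dg_space mesh deg} phi;
  phi_local : forall k : 'I_Nx, single_element_support (tnth phi k);
  Nv : nat;
  vel : 'I_Nv -> 'rV[R]_3;
  weight : 'rV[R]_Nv;
  vel_sphere : forall j, \sum_(i < 3) vel j 0 i ^+ 2 = 1;
  weight_gt0 : forall j, 0 < weight 0 j;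
  weight_sum1 : \sum_j weight 0 j = 1 }.

(* The problem  v . grad f + sigma_s (f - <f>) + sigma_a f = source  on the
   spatial domain Om, with f = inflow on the inflow boundary. *)
Record rte_data (R : realType) (d : nat) (Om : set (R * R)) := RteData {
  params : set 'rV[R]_d;
  params_compact : compact params;
  sigma_a : 'rV[R]_d -> R * R -> R;
  sigma_s : 'rV[R]_d -> R * R -> R;
  sigma_a_ge0 : forall mu p, params mu -> Om p -> 0 <= sigma_a mu p;
  sigma_s_ge0 : forall mu p, params mu -> Om p -> 0 <= sigma_s mu p;
  source : 'rV[R]_d -> 'rV[R]_3 -> R * R -> R;
  inflow : 'rV[R]_d -> 'rV[R]_3 -> R * R -> R }.

(* diag(B_0, ..., B_{n-1}); the indices of 'I_(n * p) are ordered as in [*t]. *)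
Definition blockdiag (R : nzRingType) (n p : nat) (B : 'I_n -> 'M[R]_p) :
    'M[R]_(n * p) :=
  \matrix_(i, j)
    let: (a, k) := mxtens_unindex i in
    let: (b, l) := mxtens_unindex j in
    if a == b then B a k l else 0.

Section FullOrderModel.
Variables (R : realType) (d : nat) (X : discretization R).

Definition ndof : nat := (Nv X * Nx X)%N.

Local Notation phi_ k := (tnth (phi X) k).

Definition weighted_mass_mx (sigma : R * R -> R) : 'M[R]_(Nx X) :=
  \matrix_(k, l) weighted_inner sigma (phi_ k) (phi_ l).

Definition mass_mx : 'M[R]_(Nx X) := weighted_mass_mx (fun=> 1).

Definition transport_block (j : 'I_(Nv X)) : 'M[R]_(Nx X) :=
  \matrix_(k, l) transport_form (vel j) (fun=> 0) (phi_ l) (phi_ k).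

Definition transport_mx : 'M[R]_ndof := blockdiag transport_block.

Definition Mh : 'M[R]_ndof :=
  blockdiag (fun j => weight X 0 j *: invmx mass_mx).

Variable E : rte_data d (domain (mesh X)).

Definition absorption_mx (mu : 'rV[R]_d) : 'M[R]_ndof :=
  1%:M *t weighted_mass_mx (sigma_a E mu).

Definition scattering_mx (mu : 'rV[R]_d) : 'M[R]_ndof :=
  (1%:M - (const_mx 1 : 'cV[R]_(Nv X)) *m weight X) *t
  weighted_mass_mx (sigma_s E mu).

Definition full_mx (mu : 'rV[R]_d) : 'M[R]_ndof :=
  transport_mx + scattering_mx mu + absorption_mx mu.

(* The inflow data contribute the part of the upwind form which does not
   depend on the unknown, moved to the right-hand side. *)
Definition full_rhs (mu : 'rV[R]_d) : 'cV[R]_ndof :=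
  \col_i
    let: (j, k) := mxtens_unindex i in
    source_form (source E mu (vel j)) (phi_ k) -
    transport_form (vel j) (inflow E mu (vel j)) 0 (phi_ k).

End FullOrderModel.

(** * Norms, concatenations and QR factorization *)

Definition l2norm (R : realType) (n : nat) (g : 'cV[R]_n) : R :=
  Num.sqrt (\sum_i g i 0 ^+ 2).

Definition mxnorm_of (R : realType) (n : nat) (M : 'M[R]_n) (g : 'cV[R]_n) : R :=
  Num.sqrt ((g^T *m M *m g) 0 0).

(* [A_0, ..., A_{q-1}] *)
Definition hcat (R : nzRingType) (n m q : nat) (A : 'I_q -> 'M[R]_(n, m)) :
    'M[R]_(n, q * m) :=
  \matrix_(i, j)
    let: (a, k) := mxtens_unindex j in A a i k.

Definition concat3 (T : Type) (a b : nat) (x : T) (f : 'I_a -> T)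
    (g : 'I_b -> T) (q : 'I_(1 + a + b)) : T :=
  match fintype.split q with
  | inl r => if fintype.split r is inr r' then f r' else x
  | inr r => g r
  end.

(* [is_trig_mx] means lower triangular, also for rectangular matrices. *)
Definition upper_trig (R : nzRingType) (n p : nat) (A : 'M[R]_(n, p)) : bool :=
  is_trig_mx A^T.

Definition economy_qr_pivoted (R : nzRingType) (n p s : nat)
    (B : 'M[R]_(n, p)) (Q : 'M[R]_(n, s)) (Rf : 'M[R]_(s, p))
    (P : 'M[R]_p) : Prop :=
  [/\ Q^T *m Q = 1%:M, upper_trig Rf, is_perm_mx P & Q *m Rf = B *m P].

(* Main.v *)
Require Import Defs.
From HB Require Import structures.
From mathcomp Require Import all_boot all_order all_fingroup all_algebra.
From mathcomp Require Import all_classical all_reals all_analysis.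

Set Implicit Arguments.
Unset Strict Implicit.
Unset Printing Implicit Defensive.
Import Order.TTheory GRing.Theory Num.Theory.
Import numFieldNormedType.Exports.
Local Open Scope classical_set_scope.
Local Open Scope ring_scope.

(** The Cholesky factor [G] is an isometry from the [Mh]-norm to the Euclidean
    one ([mxnorm_of_gram]), which gives the first equality.  By the affine
    decomposition, the transformed residual [G (A_mu U c - b_mu)] is a linear
    combination of the columns of the parameter-independent matrix [B]; its
    coefficients are the products of [theta^A] with the entries of [c], and the
    entries of [- theta^b].  So the residual is [B] applied to the vector that
    stacks these two families ([sum_concat3], [hcat_mul_tens], [columns_mul]).
    Since permutation matrices are orthogonal, [B = Q Rf P^T]
    ([economy_qr_pivoted_factor]), and the factor [Q], having orthonormal
    columns, preserves the Euclidean norm ([l2norm_isometry]). *)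

(** The quadratic form of [G^T G] at [g] is the Euclidean square of [G g].  With
    a Cholesky factor this is the passage to the Euclidean norm; with Gram
    matrix 1 it says that orthonormal columns preserve that norm. *)
Lemma mxnorm_of_gram (R : realType) (n p : nat) (G : 'M[R]_(p, n))
    (g : 'cV[R]_n) :
  mxnorm_of (G^T *m G) g = l2norm (G *m g).
Proof.
rewrite /mxnorm_of /l2norm; congr Num.sqrt.
rewrite mulmxA -trmx_mul -mulmxA mxE.
by apply: eq_bigr => i _; rewrite mxE expr2.
Qed.

Lemma mxnorm_of1 (R : realType) (n : nat) (g : 'cV[R]_n) :
  mxnorm_of 1%:M g = l2norm g.
Proof. by rewrite -{2}(mul1mx g) -mxnorm_of_gram trmx1 mulmx1. Qed.

Lemma l2norm_isometry (R : realType) (n s : nat) (Q : 'M[R]_(n, s))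
    (g : 'cV[R]_s) :
  Q^T *m Q = 1%:M -> l2norm (Q *m g) = l2norm g.
Proof. by move=> Qorth; rewrite -mxnorm_of_gram Qorth mxnorm_of1. Qed.

Lemma perm_mx_orthogonal (R : comNzRingType) (n : nat) (P : 'M[R]_n) :
  is_perm_mx P -> P *m P^T = 1%:M.
Proof.
by case/is_perm_mxP=> p ->; rewrite tr_perm_mx -perm_mxM mulgV perm_mx1.
Qed.

Lemma economy_qr_pivoted_factor (R : comNzRingType) (n p s : nat)
    (B : 'M[R]_(n, p)) (Q : 'M[R]_(n, s)) (Rf : 'M[R]_(s, p)) (P : 'M[R]_p) :
  economy_qr_pivoted B Q Rf P -> B = Q *m (Rf *m P^T).
Proof.
by case=> _ _ /perm_mx_orthogonal PPt QR; rewrite mulmxA QR -mulmxA PPt mulmx1.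
Qed.

(** Block by block: the q-th block of [t (x) c] is [t_q c], so the block row
    [A_0, A_1, ...] sends it to the sum of the [t_q A_q c].  The ascription is
    a conversion, the width of [t *t c] being [1 * 1]. *)
Lemma hcat_mul_tens (R : comNzRingType) (n m q : nat)
    (A : 'I_q -> 'M[R]_(n, m)) (t : 'cV[R]_q) (c : 'cV[R]_m) :
  hcat A *m (t *t c : 'cV[R]_(q * m)) = (\sum_a t a 0 *: A a) *m c.
Proof.
apply/matrixP => i j; rewrite mulmx_suml summxE mxE.
rewrite (reindex (@mxtens_index q m)) /=; last first.
  by exists (@mxtens_unindex q m) => k _;
    [apply: mxtens_indexK | apply: mxtens_unindexK].
under [RHS]eq_bigr do rewrite -scalemxAl !mxE mulr_sumr.
rewrite pair_bigA /=; apply: eq_bigr => -[a k] _ /=.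
by rewrite !mxE mxtens_indexK /= !ord1 mulrCA.
Qed.

(** The coefficients and the matrices are stacked by the same operation, so a
    sum over the stacked index splits into its three parts. *)
Lemma sum_concat3 (S T : Type) (V : nmodType) (h : S -> T -> V) (a b : nat)
    (x : S) (f : 'I_a -> S) (g : 'I_b -> S)
    (y : T) (k : 'I_a -> T) (l : 'I_b -> T) :
  \sum_q h (concat3 x f g q) (concat3 y k l q) =
    h x y + \sum_q h (f q) (k q) + \sum_q h (g q) (l q).
Proof.
rewrite big_split_ord /=; congr (_ + _); last first.
  by apply: eq_bigr => q _; rewrite /concat3 (unsplitK (inr q)).
rewrite big_split_ord big_ord1 /=; congr (_ + _).
  rewrite /concat3 (unsplitK (inl (lshift a ord0))).
  by rewrite (unsplitK (inl ord0)).
apply: eq_bigr => q _; rewrite /concat3 (unsplitK (inl (rshift 1 q))).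
by rewrite (unsplitK (inr q)).
Qed.

Lemma columns_mul (R : comNzRingType) (n q : nat) (b : 'I_q -> 'cV[R]_n)
    (t : 'cV[R]_q) :
  (\matrix_(i, a) b a i 0) *m t = \sum_a t a 0 *: b a.
Proof.
apply/matrixP => i j; rewrite summxE mxE; apply: eq_bigr => a _.
by rewrite !mxE !ord1 mulrC.
Qed.

Theorem theorem2 (R : realType) (d : nat)
  (X : discretization R) (E : rte_data d (domain (mesh X)))
  (* affine parameter dependence *)
  (Qs Qa Qb : nat)
  (theta_s : 'I_Qs -> 'rV[R]_d -> R)
  (theta_a : 'I_Qa -> 'rV[R]_d -> R)
  (theta_b : 'I_Qb -> 'rV[R]_d -> R)
  (Ss : 'I_Qs -> 'M[R]_(ndof X)) (Sa : 'I_Qa -> 'M[R]_(ndof X))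
  (bq : 'I_Qb -> 'cV[R]_(ndof X))
  (theta_s_cont : forall q, {within params E, continuous (theta_s q)})
  (theta_a_cont : forall q, {within params E, continuous (theta_a q)})
  (theta_b_cont : forall q, {within params E, continuous (theta_b q)})
  (affine_s : forall mu, params E mu ->
     scattering_mx E mu = \sum_(q < Qs) theta_s q mu *: Ss q)
  (affine_a : forall mu, params E mu ->
     absorption_mx E mu = \sum_(q < Qa) theta_a q mu *: Sa q)
  (affine_b : forall mu, params E mu ->
     full_rhs E mu = \sum_(q < Qb) theta_b q mu *: bq q)
  (* reduced basis *)
  (m : nat) (m_lt : (m < ndof X)%N)
  (mu_sel : 'I_m -> 'rV[R]_d) (mu_sel_in : forall i, params E (mu_sel i))
  (F : 'M[R]_(ndof X, m))
  (F_sol : forall i, full_mx E (mu_sel i) *m col i F = full_rhs E (mu_sel i))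
  (F_free : row_free F^T)
  (U : 'M[R]_(ndof X, m))
  (U_orth : U^T *m U = 1%:M)
  (U_span : (U^T :=: F^T)%MS)
  (* Cholesky factor *)
  (G : 'M[R]_(ndof X)) (G_upper : upper_trig G) (G_chol : Mh X = G^T *m G) :
  let QA := (1 + Qs + Qa)%N in
  let QB := (QA * m + Qb)%N in
  let Ahat : 'I_QA -> 'M[R]_(ndof X, m) :=
    concat3 (G *m transport_mx X *m U)
            (fun q => G *m Ss q *m U) (fun q => G *m Sa q *m U) in
  let bhat : 'I_Qb -> 'cV[R]_(ndof X) := fun q => G *m bq q in
  let B : 'M[R]_(ndof X, QB) :=
    row_mx (hcat Ahat) (\matrix_(i, q) bhat q i 0) in
  let thetaA (mu : 'rV[R]_d) : 'cV[R]_QA :=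
    \col_q concat3 1 (theta_s^~ mu) (theta_a^~ mu) q in
  let thetab (mu : 'rV[R]_d) : 'cV[R]_Qb := \col_q theta_b q mu in
  let Ahat_mu (mu : 'rV[R]_d) := G *m full_mx E mu *m U in
  let bhat_mu (mu : 'rV[R]_d) := G *m full_rhs E mu in
  let coeffs (mu : 'rV[R]_d) (c : 'cV[R]_m) : 'cV[R]_QB :=
    col_mx (thetaA mu *t c : 'cV[R]_(QA * m)) (- thetab mu) in
  (QB <= ndof X)%N ->
  forall (s : nat) (Q : 'M[R]_(ndof X, s)) (Rf : 'M[R]_(s, QB))
         (P : 'M[R]_QB),
  economy_qr_pivoted B Q Rf P ->
  forall (mu : 'rV[R]_d), params E mu ->
  forall c : 'cV[R]_m,
    mxnorm_of (Mh X) (full_mx E mu *m U *m c - full_rhs E mu)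
      = l2norm (Ahat_mu mu *m c - bhat_mu mu)
    /\
    l2norm (Ahat_mu mu *m c - bhat_mu mu)
      = l2norm (Rf *m P^T *m coeffs mu c).
Proof.
move=> QA QB Ahat bhat B thetaA thetab Ahat_mu bhat_mu coeffs _ s Q Rf P qr.
move=> mu mu_in c.
have residualE : G *m (full_mx E mu *m U *m c - full_rhs E mu) =
    Ahat_mu mu *m c - bhat_mu mu.
  by rewrite mulmxBr !mulmxA.
have AhatE : \sum_a thetaA mu a 0 *: Ahat a = Ahat_mu mu.
  under eq_bigr do rewrite mxE.
  rewrite (sum_concat3 (fun (x : R) (M : 'M[R]_(ndof X, m)) => x *: M)).
  rewrite /Ahat_mu /full_mx (affine_s _ mu_in) (affine_a _ mu_in) scale1r.
  rewrite !mulmxDr !mulmxDl !mulmx_sumr !mulmx_suml.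
  by congr (_ + _ + _); apply: eq_bigr => q _; rewrite -scalemxAr -scalemxAl.
have bhatE : \sum_a thetab mu a 0 *: bhat a = bhat_mu mu.
  rewrite /bhat_mu (affine_b _ mu_in) mulmx_sumr.
  by apply: eq_bigr => q _; rewrite mxE -scalemxAr.
split; first by rewrite G_chol mxnorm_of_gram residualE.
have -> : Ahat_mu mu *m c - bhat_mu mu = B *m coeffs mu c.
  by rewrite mul_row_col hcat_mul_tens AhatE mulmxN columns_mul bhatE.
have Qorth : Q^T *m Q = 1%:M by case: qr.
by rewrite (economy_qr_pivoted_factor qr) -(mulmxA Q) l2norm_isometry.
Qed.
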